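(* Let $\mathcal{V}$ be a variety of non-associative algebras over a field $\mathbb{K}$. In $\mathcal{V}$, let $f\colon A\to B$, $g\colon B\to C$, $s\colon C\to B$, $k\colon D\to E$, $q\colon E\to F$, $t\colon F\to E$, $\alpha\colon A\to D$, $\beta\colon B\to E$ and $\gamma\colon C\to F$ be morphisms such that $f$ is a kernel of $g$, $k$ is a kernel of $q$, $g\circ s=1_C$, $q\circ t=1_F$, $\beta\circ f=k\circ\alpha$, $q\circ\beta=\gamma\circ g$ and $\beta\circ s=t\circ\gamma$. If $\alpha$ and $\gamma$ are isomorphisms, then $\beta$ is an isomorphism as well.
   Context: Fix a field $\mathbb{K}$. A (non-associative) algebra over $\mathbb{K}$ is a $\mathbb{K}$-vector space $A$ with a bilinear multiplication $A\times A\to A$ (no associativity, unit, etc. is assumed). Morphisms are linear maps preserving the multiplication; the resulting category is $\mathsf{Alg}_{\mathbb{K}}$. Let $X=\{x_1,x_2,\dots\}$ be a countable set of variables and let $\mathbb{K}[M(X)]$ be the free non-associative $\mathbb{K}$-algebra on $X$ (the vector space with basis the free magma $M(X)$ on $X$, with bilinearly extended multiplication); its elements are called polynomials. A polynomial $\psi(x_1,\dots,x_n)$ is an identity of $A$ if $\psi(a_1,\dots,a_n)=0$ for all $a_1,\dots,a_n\in A$. A variety of non-associative algebras $\mathcal{V}$ is the full subcategory of $\mathsf{Alg}_{\mathbb{K}}$ consisting of all algebras satisfying every identity in some given subset of $\mathbb{K}[M(X)]$. Kernels are meant in the categorical sense in $\mathcal{V}$, whose zero object is the zero algebra. *)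

(* Defs.v *)
From HB Require Import structures.
From mathcomp Require Import all_boot all_order all_algebra.
From mathcomp Require Import finmap monalg.

Set Implicit Arguments.
Unset Strict Implicit.
Unset Printing Implicit Defensive.

Import GRing.Theory.

Local Open Scope ring_scope.

(* The product of the library's [magmaType], which carries no axiom ([monalg]
   exports another [mul]). *)
Notation "x ** y" := (@monoid.mul _ x y)
  (at level 40, left associativity) : ring_scope.

HB.mixin Record Lmodule_isNAAlgebra (K : fieldType) A
    of GRing.Lmodule K A & Magma A := {
  namulDl : forall x y z : A, (x + y) ** z = x ** z + y ** z;
  namulDr : forall x y z : A, x ** (y + z) = x ** y + x ** z;
  namulZl : forall (c : K) (x y : A), (c *: x) ** y = c *: (x ** y);
  namulZr : forall (c : K) (x y : A), x ** (c *: y) = c *: (x ** y)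
}.

#[short(type="naAlgType")]
HB.structure Definition NAAlgebra (K : fieldType) :=
  {A of GRing.Lmodule K A & Magma A & Lmodule_isNAAlgebra K A}.

HB.structure Definition NAMorphism (K : fieldType) (A B : naAlgType K) :=
  {f of @GRing.Linear K A B *:%R f & @Multiplicative A B f}.

Notation "{ 'namorphism' A -> B }" := (@NAMorphism.type _ A%type B%type)
  (at level 0, A at level 98, B at level 99,
   format "{ 'namorphism'  A  ->  B }") : type_scope.

Section MorphismInstances.
Variables (K : fieldType) (A B C : naAlgType K).

HB.instance Definition _ := GRing.Linear.on (@idfun A).

HB.instance Definition _ (g : {namorphism B -> C}) (f : {namorphism A -> B}) :=
  GRing.Linear.on (g \o f).

End MorphismInstances.

Section Products.
Variables (K : fieldType) (A : naAlgType K).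

Lemma namul0r (y : A) : 0 ** y = 0 :> A.
Proof. by rewrite -(scale0r (0 : A)) namulZl !scale0r. Qed.

Lemma namulr0 (x : A) : x ** 0 = 0 :> A.
Proof. by rewrite -(scale0r (0 : A)) namulZr !scale0r. Qed.

Lemma namul_suml (I : Type) (r : seq I) (F : I -> A) (y : A) :
  (\sum_(i <- r) F i) ** y = \sum_(i <- r) F i ** y :> A.
Proof.
by apply: (big_morph (fun x : A => x ** y) (fun a b => namulDl a b y)
             (namul0r y)).
Qed.

Lemma namul_sumr (I : Type) (r : seq I) (F : I -> A) (x : A) :
  x ** (\sum_(i <- r) F i) = \sum_(i <- r) x ** F i :> A.
Proof.
by apply: (big_morph (fun y : A => x ** y) (fun a b => namulDr x a b)
             (namulr0 x)).
Qed.

End Products.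

Inductive free_magma (X : Type) : Type :=
| fm_var of X
| fm_mul of free_magma X & free_magma X.

Section FreeMagmaChoice.
Variable X : choiceType.

Fixpoint fm_encode (w : free_magma X) : GenTree.tree X :=
  match w with
  | fm_var x => GenTree.Leaf x
  | fm_mul u v => GenTree.Node 0 [:: fm_encode u; fm_encode v]
  end.

Fixpoint fm_decode (t : GenTree.tree X) : option (free_magma X) :=
  match t with
  | GenTree.Leaf x => Some (fm_var x)
  | GenTree.Node _ [:: t1; t2] =>
      if (fm_decode t1, fm_decode t2) is (Some u, Some v)
      then Some (fm_mul u v) else None
  | _ => None
  end.

Lemma fm_encodeK : pcancel fm_encode fm_decode.
Proof. by elim=> //= u -> v ->. Qed.

HB.instance Definition _ := Choice.copy (free_magma X) (pcan_type fm_encodeK).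
HB.instance Definition _ := hasMul.Build (free_magma X) (@fm_mul X).

End FreeMagmaChoice.

Fixpoint fm_eval (X : Type) (G : magmaType) (v : X -> G) (w : free_magma X) : G :=
  match w with
  | fm_var x => v x
  | fm_mul w1 w2 => fm_eval v w1 ** fm_eval v w2
  end.

(* The algebra K[M] of a magma M has underlying space [{malg K[M]}], the
   finitely supported functions from M to K, where [<< c *g m >>] is the
   element c m; the ring product of [monalg] does not apply, as it requires M
   to be a monoid. *)
Section MagmaAlgebra.
Variables (K : fieldType) (M : ChoiceMagma.type).
Local Notation KM := {malg K[M]}.

Definition malg_namul (p q : KM) : KM :=
  \sum_(u <- msupp p) \sum_(v <- msupp q) << p@_u * q@_v *g (u ** v) >>.

Lemma malg_namulEw (d1 d2 : {fset M}) (p q : KM) :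
  (msupp p `<=` d1)%fset -> (msupp q `<=` d2)%fset ->
  malg_namul p q =
    \sum_(u <- d1) \sum_(v <- d2) << p@_u * q@_v *g (u ** v) >>.
Proof.
move=> le1 le2; rewrite /malg_namul (big_fset_incl _ le1) => [|u _ nu] /=.
  apply: eq_bigr => u _; rewrite (big_fset_incl _ le2) // => v _ nv.
  by rewrite (mcoeff_outdom nv) mulr0 monalgU0.
by rewrite big1 // => v _; rewrite (mcoeff_outdom nu) mul0r monalgU0.
Qed.

Lemma malg_namulDl (p q r : KM) :
  malg_namul (p + q) r = malg_namul p r + malg_namul q r.
Proof.
pose d := (msupp p `|` msupp q)%fset; pose e := msupp r.
rewrite (@malg_namulEw d e) ?msuppD_le ?fsubset_refl //.
rewrite (@malg_namulEw d e p) ?fsubsetUl ?fsubset_refl //.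
rewrite (@malg_namulEw d e q) ?fsubsetUr ?fsubset_refl //.
rewrite -big_split /=; apply: eq_bigr => u _; rewrite -big_split /=.
by apply: eq_bigr => v _; rewrite mcoeffD mulrDl monalgUD.
Qed.

Lemma malg_namulDr (p q r : KM) :
  malg_namul p (q + r) = malg_namul p q + malg_namul p r.
Proof.
pose d := (msupp q `|` msupp r)%fset; pose e := msupp p.
rewrite (@malg_namulEw e d) ?msuppD_le ?fsubset_refl //.
rewrite (@malg_namulEw e d p q) ?fsubsetUl ?fsubset_refl //.
rewrite (@malg_namulEw e d p r) ?fsubsetUr ?fsubset_refl //.
rewrite -big_split /=; apply: eq_bigr => u _; rewrite -big_split /=.
by apply: eq_bigr => v _; rewrite mcoeffD mulrDr monalgUD.
Qed.

Lemma malgZU (c d : K) (m : M) : << c * d *g m >> = c *: << d *g m >> :> KM.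
Proof. by apply/malgP => k; rewrite mcoeffZ !mcoeffU mulrnAr. Qed.

Lemma malg_namulZl (c : K) (p q : KM) :
  malg_namul (c *: p) q = c *: malg_namul p q.
Proof.
rewrite (@malg_namulEw (msupp p) (msupp q)) ?msuppZ_le ?fsubset_refl //.
rewrite /malg_namul scaler_sumr; apply: eq_bigr => u _.
rewrite scaler_sumr; apply: eq_bigr => v _.
by rewrite mcoeffZ -mulrA (malgZU c).
Qed.

Lemma malg_namulZr (c : K) (p q : KM) :
  malg_namul p (c *: q) = c *: malg_namul p q.
Proof.
rewrite (@malg_namulEw (msupp p) (msupp q)) ?msuppZ_le ?fsubset_refl //.
rewrite /malg_namul scaler_sumr; apply: eq_bigr => u _.
rewrite scaler_sumr; apply: eq_bigr => v _.
by rewrite mcoeffZ mulrCA (malgZU c).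
Qed.

HB.instance Definition _ := hasMul.Build (malg M K) malg_namul.
HB.instance Definition _ := Lmodule_isNAAlgebra.Build K (malg M K)
  malg_namulDl malg_namulDr malg_namulZl malg_namulZr.

Lemma malg_namulUU (c d : K) (u v : M) :
  << c *g u >> ** << d *g v >> = << c * d *g (u ** v) >> :> KM.
Proof.
rewrite [LHS](@malg_namulEw [fset u]%fset [fset v]%fset) ?msuppU_le //.
by rewrite !big_seq_fset1 !mcoeffUU.
Qed.

End MagmaAlgebra.

(* The variables x_1, x_2, ... are indexed by [nat]. *)
Notation nonassoc_poly K := {malg K[free_magma nat]}.

Section Evaluation.
Variables (K : fieldType) (A : naAlgType K).

Definition npeval (a : nat -> A) (psi : nonassoc_poly K) : A :=
  \sum_(w <- msupp psi) psi@_w *: fm_eval a w.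

Definition is_identity (psi : nonassoc_poly K) : Prop :=
  forall a : nat -> A, npeval a psi = 0.

(* [npeval a] is the algebra morphism from the free algebra to A that maps the
   variable x_i to a i. *)
Variable a : nat -> A.

Lemma npevalEw (d : {fset free_magma nat}) (psi : nonassoc_poly K) :
  (msupp psi `<=` d)%fset ->
  npeval a psi = \sum_(w <- d) psi@_w *: fm_eval a w.
Proof.
move=> le_d; rewrite /npeval (big_fset_incl _ le_d) // => w _ nw.
by rewrite (mcoeff_outdom nw) scale0r.
Qed.

Lemma npeval_is_linear : linear (npeval a).
Proof.
move=> c p q; pose d := (msupp p `|` msupp q)%fset.
have led : (msupp (c *: p + q) `<=` d)%fset.
  by rewrite (fsubset_trans (msuppD_le _ _)) // fsetSU // msuppZ_le.
rewrite !(@npevalEw d) ?fsubsetUl ?fsubsetUr // scaler_sumr -big_split /=.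
by apply: eq_bigr => w _; rewrite mcoeffD mcoeffZ scalerDl scalerA.
Qed.

HB.instance Definition _ :=
  GRing.isLinear.Build K (nonassoc_poly K) A *:%R (npeval a) npeval_is_linear.

Lemma npevalU (c : K) (w : free_magma nat) :
  npeval a << c *g w >> = c *: fm_eval a w.
Proof.
by rewrite (@npevalEw [fset w]%fset) ?msuppU_le // big_seq_fset1 mcoeffUU.
Qed.

Lemma npeval_var (i : nat) : npeval a << fm_var i >> = a i.
Proof. by rewrite npevalU scale1r. Qed.

Lemma npevalM : {morph npeval a : p q / p ** q}.
Proof.
move=> p q; rewrite [in LHS]/monoid.mul /= /malg_namul linear_sum /=.
rewrite [npeval a p in RHS]/npeval namul_suml; apply: eq_bigr => u _.
rewrite linear_sum /= [in RHS]/npeval namul_sumr; apply: eq_bigr => v _.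
by rewrite namulZl namulZr scalerA npevalU.
Qed.

HB.instance Definition _ :=
  monoid.isMultiplicative.Build (nonassoc_poly K) A (npeval a) npevalM.

End Evaluation.

Section Variety.
Variable K : fieldType.

(* The objects of the variety defined by a set I of polynomials; as the variety
   is a full subcategory, its morphisms are the [{namorphism A -> B}]. *)
Record variety (I : nonassoc_poly K -> Prop) := Variety {
  variety_alg :> naAlgType K;
  varietyP : forall psi, I psi -> is_identity variety_alg psi
}.

(* The zero morphism, which factors through the zero algebra, is [\0]. *)
Definition is_kernel (I : nonassoc_poly K -> Prop) (A B C : variety I)
    (f : {namorphism A -> B}) (g : {namorphism B -> C}) : Prop :=
  g \o f =1 \0 /\
  forall (Z : variety I) (h : {namorphism Z -> B}), g \o h =1 \0 ->
    exists u : {namorphism Z -> A}, f \o u =1 h /\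
      forall u' : {namorphism Z -> A}, f \o u' =1 h -> u' =1 u.

Definition is_iso (I : nonassoc_poly K -> Prop) (A B : variety I)
    (f : {namorphism A -> B}) : Prop :=
  exists g : {namorphism B -> A}, g \o f =1 idfun /\ f \o g =1 idfun.

End Variety.

(* Main.v *)
(* The zero set of a morphism is a subalgebra, hence lies in the variety. Testing
   the universal property of a kernel f of g on it shows that f is injective
   (test on the zero set of f, where the inclusion and the zero morphism are
   equalized by f) and that f maps onto the zero set of g. The lemma is then a
   diagram chase in vector spaces: a preimage of e is built from a preimage under
   k of e - t (q e), and a bijective morphism has a multiplicative inverse. *)
Require Import Defs.
From HB Require Import structures.
From mathcomp Require Import all_boot all_order all_algebra.
From mathcomp Require Import finmap monalg.

Set Implicit Arguments.
Unset Strict Implicit.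
Unset Printing Implicit Defensive.

Local Open Scope ring_scope.

Import GRing.Theory.

Section NAMorphismTheory.
Variables (K : fieldType) (A B : naAlgType K).

Lemma fm_eval_morph (h : {namorphism A -> B}) (a : nat -> A) (w : free_magma nat) :
  h (fm_eval a w) = fm_eval (h \o a) w.
Proof. by elim: w => //= u <- v <-; rewrite monoid.gmulfM. Qed.

Lemma npeval_morph (h : {namorphism A -> B}) (a : nat -> A) (psi : nonassoc_poly K) :
  h (npeval a psi) = npeval (h \o a) psi.
Proof.
rewrite linear_sum; apply: eq_bigr => w _.
by rewrite linearZ /= fm_eval_morph.
Qed.

(** Morphisms commute with evaluation, so every value of [psi] in [A] is sent by [h] to a value in
    [B], that is, to 0. Applied to an inclusion, this puts subalgebras in the variety. *)
Lemma is_identity_inj (h : {namorphism A -> B}) (psi : nonassoc_poly K) :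
  injective h -> is_identity B psi -> is_identity A psi.
Proof.
by move=> inj_h idB a; apply: inj_h; rewrite npeval_morph idB linear0.
Qed.

Lemma null_is_multiplicative : {morph (\0 : A -> B) : x y / x ** y}.
Proof. by move=> x y; rewrite namul0r. Qed.

HB.instance Definition _ :=
  monoid.isMultiplicative.Build A B \0 null_is_multiplicative.

(** Bundled as an algebra morphism so that it can serve as a test morphism in the universal property
    of a kernel. *)
Definition null_namorphism : {namorphism A -> B} := \0.

End NAMorphismTheory.

Section Kernel.
Variables (K : fieldType) (A B : naAlgType K) (h : {namorphism A -> B}).

Definition naker : {pred A} := [pred x | h x == 0].

Lemma naker_submod_closed : submod_closed naker.
Proof.
split=> [|c x y]; rewrite !inE ?linear0 //.
by move=> /eqP hx /eqP hy; rewrite linearP /= hx hy scaler0 addr0.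
Qed.

HB.instance Definition _ := GRing.isSubmodClosed.Build K A naker naker_submod_closed.

Definition naker_alg := {x : A | x \in naker}.

HB.instance Definition _ := SubChoice.on naker_alg.
HB.instance Definition _ := [SubChoice_isSubLmodule of naker_alg by <:].

Lemma naker_mul_subproof (x y : naker_alg) : val x ** val y \in naker.
Proof.
by rewrite inE monoid.gmulfM /= (eqP (valP x)) namul0r.
Qed.

Definition naker_mul (x y : naker_alg) : naker_alg :=
  exist _ (val x ** val y) (naker_mul_subproof x y).

HB.instance Definition _ := hasMul.Build naker_alg naker_mul.

Lemma naker_valM : {morph (val : naker_alg -> A) : x y / x ** y}.
Proof. by []. Qed.

Let naker_namulDl (x y z : naker_alg) : (x + y) ** z = x ** z + y ** z.
Proof. by apply: val_inj; rewrite naker_valM !linearD /= namulDl. Qed.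

Let naker_namulDr (x y z : naker_alg) : x ** (y + z) = x ** y + x ** z.
Proof. by apply: val_inj; rewrite naker_valM !linearD /= namulDr. Qed.

Let naker_namulZl (c : K) (x y : naker_alg) : (c *: x) ** y = c *: (x ** y).
Proof. by apply: val_inj; rewrite naker_valM !linearZ /= namulZl. Qed.

Let naker_namulZr (c : K) (x y : naker_alg) : x ** (c *: y) = c *: (x ** y).
Proof. by apply: val_inj; rewrite naker_valM !linearZ /= namulZr. Qed.

HB.instance Definition _ := Lmodule_isNAAlgebra.Build K naker_alg
  naker_namulDl naker_namulDr naker_namulZl naker_namulZr.

HB.instance Definition _ :=
  monoid.isMultiplicative.Build naker_alg A (val : naker_alg -> A) naker_valM.

Definition naker_incl : {namorphism naker_alg -> A} := (val : naker_alg -> A).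

Lemma naker_inclK (x : naker_alg) : h (naker_incl x) = 0.
Proof. exact/eqP/(valP x). Qed.

End Kernel.

Section VarietyTheory.
Variables (K : fieldType) (I : nonassoc_poly K -> Prop).
Implicit Types A B C : variety I.

Definition naker_variety A B (h : {namorphism A -> B}) : variety I :=
  Variety (fun psi Ipsi =>
    @is_identity_inj _ _ _ (naker_incl h) psi val_inj (varietyP Ipsi)).

Lemma kernel_inj A B C (f : {namorphism A -> B}) (g : {namorphism B -> C}) :
  is_kernel f g -> injective f.
Proof.
move=> [_ univ].
have f_eq0 x : f x = 0 -> x = 0.
  move=> fx0; pose Z := naker_variety f.
  (* Both the inclusion of [Z] and the zero map [Z -> A] become zero after [f], so uniqueness
     equates each of them with [u]. *)
  have [u [_ uniq_u]] := univ Z (null_namorphism Z B) (fun=> linear0 g).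
  have incl_u := uniq_u (naker_incl f) (@naker_inclK _ _ _ f).
  have null_u := uniq_u (null_namorphism Z A) (fun=> linear0 f).
  have x_ker : x \in naker f by apply/eqP.
  by have := incl_u (exist _ x x_ker); rewrite -null_u.
by move=> x y fxy; apply/eqP; rewrite -subr_eq0 (f_eq0 (x - y)) // linearB /= fxy subrr.
Qed.

Lemma kernel_exact A B C (f : {namorphism A -> B}) (g : {namorphism B -> C}) b :
  is_kernel f g -> g b = 0 -> exists a, f a = b.
Proof.
move=> [_ univ] gb0; have b_ker : b \in naker g by apply/eqP.
(* The inclusion of the zero set of [g] factors through [f], and the factorization evaluated at [b]
   is a preimage. *)
have [u [fu _]] := univ (naker_variety g) (naker_incl g) (@naker_inclK _ _ _ g).
by exists (u (exist _ b b_ker)); exact: fu.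
Qed.

Lemma is_iso_bij A B (h : {namorphism A -> B}) :
  injective h -> (forall b, exists a, h a = b) -> is_iso h.
Proof.
move=> inj_h surj_h.
(* The boolean equation lets [xchoose] select preimages without a choice axiom. *)
have ex_inv b : exists a, h a == b by have [a <-] := surj_h b; exists a.
pose h' b := xchoose (ex_inv b).
have h'K : cancel h' h by move=> b; exact/eqP/(xchooseP (ex_inv b)).
have hK : cancel h h' by move=> a; apply: inj_h; rewrite h'K.
pose lin_h' := GRing.isLinear.Build K B A *:%R h' (can2_linear hK h'K).
pose mul_h' := monoid.isMultiplicative.Build B A h' (monoid.can2_gmulfM hK h'K).
pose H' : {namorphism B -> A} := HB.pack h' lin_h' mul_h'.
by exists H'; split.
Qed.

End VarietyTheory.

Theorem theorem6p5 (K : fieldType) (I : nonassoc_poly K -> Prop)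
    (A B C D E F : variety I)
    (f : {namorphism A -> B}) (g : {namorphism B -> C}) (s : {namorphism C -> B})
    (k : {namorphism D -> E}) (q : {namorphism E -> F}) (t : {namorphism F -> E})
    (alpha : {namorphism A -> D}) (beta : {namorphism B -> E})
    (gamma : {namorphism C -> F})
    (ker_f : is_kernel f g) (ker_k : is_kernel k q)
    (gs : g \o s =1 idfun) (qt : q \o t =1 idfun)
    (left_sq : beta \o f =1 k \o alpha)
    (right_sq : q \o beta =1 gamma \o g)
    (sect_sq : beta \o s =1 t \o gamma)
    (iso_alpha : is_iso alpha) (iso_gamma : is_iso gamma) :
  is_iso beta.
Proof.
have [alpha' [alphaK alpha'K]] := iso_alpha.
have [gamma' [gammaK gamma'K]] := iso_gamma.
apply: is_iso_bij => [x y bxy|e].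
  have b0 : beta (x - y) = 0 by rewrite linearB /= bxy subrr.
  have g0 : g (x - y) = 0.
    (* Here [g = gamma' \o gamma \o g = gamma' \o q \o beta], which vanishes at [x - y]. *)
    rewrite -[LHS]gammaK /=; have /= <- := right_sq (x - y).
    by rewrite b0 !linear0.
  have [a fa] := kernel_exact ker_f g0.
  have a0 : a = 0.
    rewrite -[a]alphaK /= (_ : alpha a = 0) ?linear0 //.
    (* As [k (alpha a) = beta (f a) = beta (x - y) = 0], injectivity of [k] gives [alpha a = 0]. *)
    apply: (kernel_inj ker_k); have /= <- := left_sq a.
    by rewrite fa b0 linear0.
  by apply/eqP; rewrite -subr_eq0 -fa a0 linear0.
have q0 : q (e - t (q e)) = 0.
  by rewrite linearB; have /= -> := qt (q e); rewrite subrr.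
have [d kd] := kernel_exact ker_k q0.
(* Under [beta] the first summand goes to [k d = e - t (q e)] and the second to [t (q e)]. *)
exists (f (alpha' d) + s (gamma' (q e))); rewrite linearD.
have /= -> := left_sq (alpha' d); have /= -> := sect_sq (gamma' (q e)).
have /= -> := alpha'K d; have /= -> := gamma'K (q e).
by rewrite kd subrK.
Qed.
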